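(* Let $m\ge 0$ and $t\ge 1$ be integers. Let $N(t,m)$ be the tree obtained from a single edge (two vertices joined by an edge) by applying the $(1,m)$-star-fractal operation $t$ times, and let $\mathcal{S}(t,m)$ be its geodesic distance. Then $$\mathcal{S}(t,m)=\frac{(m^{2}+2m+1)2^{t}+2m+3}{2m+3}(m+2)^{2t-1}+(m+2)^{t}-\frac{(m+2)^{2}}{2m+3}(m+2)^{t-1}.$$
   Context: The geodesic distance of a finite connected graph $\mathcal{G}$ with vertex set $\mathcal{V}$ is the total $\mathcal{S}=\sum_{\{u,v\}} d_{uv}$, summed over all unordered pairs of distinct vertices $u,v\in\mathcal{V}$, where $d_{uv}$ is the number of edges of a shortest path joining $u$ and $v$. The $(1,m)$-star-fractal operation on a graph does the following to every edge $uv$: it inserts a new vertex $w$ into the edge (replacing $uv$ by the path $uwv$), and attaches $m$ further new vertices $w_1,\dots,w_m$ to $w$, each by an edge to $w$ (all new vertices distinct for distinct edges). The case $m=0$ is first-order subdivision. Applying the operation $t$ times means iterating: each application acts on every edge of the graph produced by the previous application. *)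

(* Defs.v *)
From mathcomp Require Import all_boot.
Set Implicit Arguments.
Unset Strict Implicit.
Unset Printing Implicit Defensive.


Record sgraph := SGraph {
  vertex :> finType;
  adj : rel vertex;
  adj_sym : symmetric adj;
  adj_irrefl : irreflexive adj
}.

Definition connected (G : sgraph) : Prop :=
  forall u v : G, connect (@adj G) u v.

Definition walk_of_length (G : sgraph) (u v : G) (k : nat) : bool :=
  [exists p : k.-tuple G, path (@adj G) u p && (last u p == v)].

(* The least k admitting a walk with k edges from u to v.  A shortest path has
   fewer than #|G| edges; #|G| is the default value if v is unreachable from u
   (see [dist_path], [dist_min]). *)
Definition dist (G : sgraph) (u v : G) : nat :=
  find (walk_of_length u v) (iota 0 #|G|).

(* Each unordered pair of distinct vertices is counted once, listed in the
   order of the enumeration of the vertex type. *)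
Definition geodesic_distance (G : sgraph) : nat :=
  \sum_(u : G) \sum_(v : G | enum_rank u < enum_rank v) dist u v.

Lemma dist_min (G : sgraph) (u v : G) (p : seq G) :
  path (@adj G) u p -> last u p = v -> dist u v <= size p.
Proof.
move=> hp hl; rewrite /dist leqNgt; apply/negP=> hlt.
have hs : size p < #|G|.
  by apply: (leq_trans hlt); rewrite -[X in _ <= X](size_iota 0) find_size.
have := before_find 0 hlt; rewrite nth_iota // add0n => /negbT/negP; apply.
by rewrite /walk_of_length; apply/existsP; exists (in_tuple p); rewrite /= hp hl eqxx.
Qed.

Lemma dist_path (G : sgraph) (u v : G) : connect (@adj G) u v ->
  exists p : seq G, [/\ path (@adj G) u p, last u p = v & size p = dist u v].
Proof.
case/connectP=> p0 hp0 hl0.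
have [p [hp hl hs]] :
    exists p, [/\ path (@adj G) u p, last u p = v & size p < #|G|].
  rewrite {v}hl0; case/shortenP: hp0 => p hp hu _; exists p; split=> //.
  by rewrite -[(size p).+1]/(size (u :: p)) -(card_uniqP hu) max_card.
have hh : has (walk_of_length u v) (iota 0 #|G|).
  apply/hasP; exists (size p); first by rewrite mem_iota.
  by rewrite /walk_of_length; apply/existsP; exists (in_tuple p); rewrite /= hp hl eqxx.
have := nth_find 0 hh; rewrite nth_iota ?add0n -/(dist u v); last first.
  by rewrite -[X in _ < X](size_iota 0) -has_find.
by case/existsP=> q /andP[hq /eqP hlq]; exists q; rewrite size_tuple.
Qed.

Definition is_edge (G : sgraph) (e : {set G}) : bool :=
  [exists u : G, exists v : G, adj u v && (e == [set u; v])].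

Definition edge (G : sgraph) : finType := {e : {set G} | is_edge e}.

Section StarFractal.
Variables (m : nat) (G : sgraph).

(* inl u is an old vertex; inr (e, None) is the vertex w inserted into the
   edge e, and inr (e, Some i) is the i-th pendant vertex attached to w. *)
Definition star_fractal_vertex : finType := (G + edge G * option 'I_m)%type.

Definition star_fractal_adj : rel star_fractal_vertex := fun x y =>
  match x, y with
  | inl u, inr (e, None) => u \in val e
  | inr (e, None), inl u => u \in val e
  | inr (e, None), inr (f, Some _) => e == f
  | inr (e, Some _), inr (f, None) => e == f
  | _, _ => false
  end.

Lemma star_fractal_sym : symmetric star_fractal_adj.
Proof. by move=> [u|[e [i|]]] [v|[f [j|]]] //=; rewrite eq_sym. Qed.

Lemma star_fractal_irrefl : irreflexive star_fractal_adj.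
Proof. by move=> [u|[e [i|]]]. Qed.

Definition star_fractal : sgraph :=
  SGraph star_fractal_sym star_fractal_irrefl.

Lemma star_fractal_connected : connected G -> connected star_fractal.
Proof.
move=> cG.
have sym : connect_sym (@adj star_fractal).
  by apply: sym_connect_sym; apply: star_fractal_sym.
have old u v : connect (@adj star_fractal) (inl u) (inl v).
  have /connectP[p] := cG u v.
  elim: p u => [|w p IH] u /=; first by move=> _ ->; apply: connect0.
  case/andP=> uw hp hl; apply: connect_trans (IH w hp hl).
  have he : is_edge [set u; w].
    by apply/existsP; exists u; apply/existsP; exists w; rewrite uw eqxx.
  pose e : edge G := exist _ [set u; w] he.
  apply: (@connect_trans _ _ (inr (e, None))); apply: connect1.
    by rewrite /= !inE eqxx.
  by rewrite /= !inE eqxx orbT.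
have mid (e : edge G) :
    exists u : G, connect (@adj star_fractal) (inl u) (inr (e, None)).
  have /existsP[u /existsP[v /andP[_ /eqP E]]] := valP e.
  by exists u; apply: connect1; rewrite /= E !inE eqxx.
have any (x : star_fractal) : exists u : G, connect (@adj star_fractal) (inl u) x.
  case: x => [u|[e [i|]]]; [by exists u; apply: connect0 | | exact: mid].
  have [u hu] := mid e; exists u; apply: connect_trans hu _.
  by apply: connect1; rewrite /= eqxx.
move=> x y; have [u hu] := any x; have [v hv] := any y.
by rewrite sym in hu; apply: connect_trans hu (connect_trans (old u v) hv).
Qed.

End StarFractal.

Definition single_edge_adj : rel bool := fun u v => u != v.

Lemma single_edge_sym : symmetric single_edge_adj.
Proof. by move=> u v; rewrite /single_edge_adj eq_sym. Qed.

Lemma single_edge_irrefl : irreflexive single_edge_adj.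
Proof. by move=> u; rewrite /single_edge_adj eqxx. Qed.

Definition single_edge : sgraph := SGraph single_edge_sym single_edge_irrefl.

Definition N (t m : nat) : sgraph := iter t (star_fractal m) single_edge.

Lemma N_connected (t m : nat) : connected (N t m).
Proof.
elim: t => [|t IH]; last exact: star_fractal_connected.
move=> u v; have [->|uv] := eqVneq u v; first exact: connect0.
exact: connect1.
Qed.

(* Main.v *)
Require Import Defs.
From mathcomp Require Import all_boot all_order all_algebra.
From mathcomp Require Import zify ring.
Set Implicit Arguments.
Unset Strict Implicit.
Unset Printing Implicit Defensive.
Import GRing.Theory Num.Theory.
Local Open Scope ring_scope.

(** Write [D x] for the transmission of [x], the sum of its distances to all
    vertices, so that the geodesic distance is half the sum of the [D x].  For
    a tree [G] with [E] edges and its star fractal [H] the proof establishes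
    the recurrence
      [S(H) + (m+2) E (E+m+1) = 2 (m+2)^2 S(G)]
    ([geodesic_distance_star_fractal]).  Since [H] is again a tree, with
    [(m+2) E] edges, the closed form follows by induction from [S = E = 1] for
    a single edge.

    In a tree, seen from a vertex [u], every vertex other than [u] has exactly
    one neighbour closer to [u], and all its other neighbours are farther
    ([tree_counts]).  Two identities follow:
    - summing the distances from [u] over both ends of every edge gives
      [2 D u - E] ([sum_degree_dist]), because the edges correspond to the
      vertices other than [u] through their far end;
    - the transmissions of the neighbours of [w] sum to
      [deg w (D w + n) - 2 E], with [n] the number of vertices
      ([sum_transmission_neighbours]).

    Distances in [H] need to be known explicitly only from the old vertices
    ([dist_oldE]): old distances double, and the vertex inserted into an edge
    is at distance the sum of the old distances to its two ends.  With the
    first identity in [G], this gives [D] in [H] at the old vertices.  The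
    second identity, applied in [H] at the pendant vertices and then at the
    inserted ones, expresses [D] at the new vertices through [D] at the old
    ones, so distances between two new vertices are never computed.  Summing
    [D] at the inserted vertices over all edges brings in
    [sum_u deg u * D u], which the first identity evaluates too
    ([sum_degree_transmission]). *)

(** * Distances in a connected graph *)

Section Distance.
Local Open Scope nat_scope.
Variable G : sgraph.
Implicit Types u v w x y : G.

(** A function that changes by at most one along edges is bounded by the
    distance; one that can always be decreased by moving to a neighbour is
    bounded below by it.  This replaces any reasoning on walks when computing
    distances in a concrete graph. *)
Lemma dist_eqP u (f : G -> nat) :
    f u = 0 -> (forall x y, adj x y -> f y <= (f x).+1) ->
    (forall x, x != u -> exists2 y, adj x y & f y < f x) ->
  forall v, dist u v = f v.
Proof.
move=> f0 flip fdesc v.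
have [p [pth lst szp]] :
    exists p, [/\ path (@adj G) u p, last u p = v & size p <= f v].
  have [n] := ubnP (f v); elim: n v => // n IH v fv.
  have [->|vu] := eqVneq v u; first by exists [::].
  have [y vy fyv] := fdesc _ vu.
  have [p [pth lst szp]] := IH y (leq_trans fyv fv).
  exists (rcons p v); rewrite last_rcons size_rcons rcons_path pth lst adj_sym vy.
  by split=> //; apply: leq_trans fyv.
have walk_lip q z : path (@adj G) z q -> f (last z q) <= f z + size q.
  elim: q z => [|y q IH] z /=; first by rewrite addn0.
  case/andP=> zy /IH; move/leq_trans; apply; rewrite addnS -addSn leq_add2r.
  exact: flip.
apply/eqP; rewrite eqn_leq (leq_trans (dist_min pth lst) szp) /=.
have [|q [qth qlst <-]] := @dist_path G u v; first by apply/connectP; exists p.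
by rewrite -qlst -[size q]add0n -f0 walk_lip.
Qed.

Lemma dist_refl u : dist u u = 0.
Proof. by apply/eqP; rewrite -leqn0; apply: (@dist_min G u u [::]). Qed.

Hypothesis cG : connected G.

Lemma dist_adj u x y : adj x y -> dist u y <= (dist u x).+1.
Proof.
move=> xy; have [p [pth lst <-]] := dist_path (cG u x).
by rewrite -(size_rcons p y) dist_min ?last_rcons // rcons_path pth lst.
Qed.

Lemma dist_closer u v : v != u -> exists2 w, adj v w & dist u w < dist u v.
Proof.
have [p [pth lst <-]] := dist_path (cG u v).
case/lastP: p pth lst => [|p z] /=; first by move=> _ ->; rewrite eqxx.
rewrite rcons_path last_rcons size_rcons => /andP[pth lz] <- _.
by exists (last u p); [rewrite adj_sym | rewrite ltnS dist_min].
Qed.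

Lemma dist_sym u v : dist u v = dist v u.
Proof.
apply: (@dist_eqP u (fun w => dist w u)) => [|x y xy|x].
- exact: dist_refl.
- have [p [pth lst <-]] := dist_path (cG x u).
  by apply: (@dist_min G y u (x :: p)); rewrite //= adj_sym xy.
have [[|y p] [/= pth lst <-]] := dist_path (cG x u).
  by rewrite lst eqxx.
by case/andP: pth => xy pth _; exists y; rewrite ?ltnS ?dist_min.
Qed.

Definition transmission u := \sum_v dist u v.

Lemma geodesic_distance2 :
  2 * geodesic_distance G = \sum_(u : G) transmission u.
Proof.
have -> : \sum_(u : G) transmission u
      = \sum_(u : G) \sum_(v : G | enum_rank u < enum_rank v) dist u v
      + \sum_(u : G) \sum_(v : G | enum_rank v < enum_rank u) dist u v.
  rewrite -big_split; apply: eq_bigr => u _ /=.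
  rewrite [X in _ = X + _]big_mkcond [X in _ = _ + X]big_mkcond -big_split.
  apply: eq_bigr => v _ /=; case: ltngtP => [||/val_inj/enum_rank_inj ->] //.
    by rewrite addn0.
  by rewrite dist_refl.
rewrite mul2n -addnn; congr (_ + _).
rewrite [RHS](exchange_big_dep predT) //=.
rewrite /geodesic_distance.
by apply: eq_bigr => u _; apply: eq_bigr => v _; rewrite dist_sym.
Qed.

End Distance.

(** * Degrees and edges *)

Lemma card_sum_mem (T : finType) (A : pred T) : #|A| = (\sum_x (x \in A))%N.
Proof. by rewrite -sum1_card big_mkcond. Qed.

Section Degree.
Local Open Scope nat_scope.
Variable G : sgraph.
Implicit Types (u v : G) (e : edge G).

Definition degree u := #|[pred v | adj u v]|.

Lemma edge_ends e :
  exists a b, [/\ adj a b, a != b & val e = [set a; b]].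
Proof.
have /existsP[a /existsP[b /andP[ab /eqP E]]] := valP e.
by exists a, b; split=> //; apply: contraL ab => /eqP->; rewrite adj_irrefl.
Qed.

Lemma edge_of_adj u v : adj u v -> exists e : edge G, val e = [set u; v].
Proof.
move=> uv; have he : is_edge [set u; v].
  by apply/existsP; exists u; apply/existsP; exists v; rewrite uv eqxx.
by exists (exist (fun s => is_edge s) _ he).
Qed.

Lemma sum_ends (F : G -> nat) a b : a != b ->
  \sum_(x in [set a; b]) F x = F a + F b.
Proof. by move=> ab; rewrite big_setU1 ?inE // big_set1. Qed.

(** An edge at [u] is determined by its other end. *)
Lemma card_incident u : #|[pred e : edge G | u \in val e]| = degree u.
Proof.
have inj : {in [pred v | adj u v] &, injective (fun v => [set u; v])}.
  move=> v w; rewrite !inE => uv uw E.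
  have: v \in [set u; w] by rewrite -E !inE eqxx orbT.
  rewrite !inE => /orP[/eqP vu|/eqP//].
  by move: uv; rewrite vu adj_irrefl.
rewrite /degree -(card_in_imset inj) -(card_imset _ val_inj).
apply: eq_card => s; apply/imsetP/imsetP.
  case=> e; rewrite inE => ue ->; have [a [b [ab nab E]]] := edge_ends e.
  move: ue; rewrite E !inE => /orP[]/eqP->; first by exists b.
  by exists a; [rewrite inE adj_sym | rewrite setUC].
case=> v; rewrite inE => /edge_of_adj[e E] ->.
by exists e; rewrite // inE E !inE eqxx.
Qed.

Lemma sum_edge_ends (F : G -> nat) :
  \sum_(e : edge G) \sum_(u in val e) F u = \sum_u degree u * F u.
Proof.
rewrite (exchange_big_dep predT) //=; apply: eq_bigr => u _.
by rewrite sum_nat_const -card_incident.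
Qed.

Lemma sum_edge_const k : \sum_(e : edge G) k = #|edge G| * k.
Proof. exact: sum_nat_const. Qed.

Lemma handshake : \sum_u degree u = 2 * #|edge G|.
Proof.
rewrite mulnC -sum_nat_const.
under eq_bigr do rewrite -[degree _]muln1.
rewrite -sum_edge_ends; apply: eq_bigr => e _.
by have [a [b [_ ab ->]]] := edge_ends e; rewrite sum_ends.
Qed.

End Degree.

(** * Trees *)

(** Connectedness with an edge count, rather than acyclicity, because both
    parts pass to the star fractal by direct computation. *)
Definition tree (G : sgraph) := connected G /\ #|G| = #|edge G|.+1.

Section Tree.
Local Open Scope nat_scope.
Variable G : sgraph.
Hypothesis tG : tree G.
Implicit Types u v w x y : G.

Let cG : connected G := tG.1.

Definition closer u v := [pred w : G | adj v w & dist u w < dist u v].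
Definition level u v := [pred w : G | adj v w & dist u w == dist u v].
Definition farther u v := [pred w : G | adj v w & dist u v < dist u w].

(** [w] is closer than [v] exactly when [v] is farther than [w], so reversing
    the arcs exchanges the two kinds of neighbours. *)
Lemma sum_farther u (F : G -> nat) :
  \sum_v \sum_(w in farther u v) F v = \sum_v \sum_(w in closer u v) F w.
Proof.
rewrite (exchange_big_dep predT) //=; apply: eq_bigr => v _.
by apply: eq_bigl => w; rewrite !inE adj_sym.
Qed.

Lemma card_neq u : \sum_v (v != u : nat) = #|edge G|.
Proof.
rewrite -[RHS]/(#|edge G|.+1.-1) -tG.2 -(cardC1 u) -sum1_card.
by rewrite [RHS]big_mkcond.
Qed.

Lemma degree_split u v :
  degree v = #|closer u v| + #|level u v| + #|farther u v|.
Proof.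
rewrite /degree !card_sum_mem -!big_split; apply: eq_bigr => w _ /=.
by rewrite !inE; case: (adj v w); case: ltngtP.
Qed.

(** Every vertex other than [u] has at least one closer neighbour, which gives
    at least [n - 1] arcs towards [u] and as many away from it.  A tree has
    only [2 (n - 1)] arcs in all, so every inequality is an equality and no
    arc joins two vertices at the same distance. *)
Lemma tree_counts u :
  (forall v, #|closer u v| = (v != u)) /\ (forall v, #|level u v| = 0).
Proof.
have le v : (v != u : nat) <= #|closer u v|.
  have [//|vu] := eqVneq v u; apply/card_gt0P.
  by have [w vw lt] := dist_closer cG vu; exists w; rewrite inE vw.
have far : \sum_v #|farther u v| = \sum_v #|closer u v|.
  have := sum_farther u (fun=> 1).
  by under eq_bigr do rewrite sum1_card;
     under [in RHS]eq_bigr do rewrite sum1_card.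
have := handshake G; under eq_bigr do rewrite (degree_split u).
rewrite !big_split /= far => tot.
have le_sum : \sum_v (v != u : nat) <= \sum_v #|closer u v| by apply: leq_sum.
have arith (c l e : nat) : e <= c -> c + l + c = 2 * e -> l = 0 /\ e = c by lia.
rewrite -(card_neq u) in tot; have [sum_level eq_sum] := arith _ _ _ le_sum tot.
split=> v; last first.
  by apply/eqP; move/eqP: sum_level; rewrite sum_nat_eq0 => /forallP/(_ v).
have : \sum_v (v != u : nat) <= \sum_v #|closer u v|
         ?= iff [forall v, (v != u : nat) == #|closer u v|].
  by apply: leqif_sum => i _; split.
by case=> _; rewrite eq_sum eqxx => /esym/forallP/(_ v)/eqP.
Qed.

Lemma card_closer u v : #|closer u v| = (v != u).
Proof. exact: (tree_counts u).1. Qed.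

Lemma dist_adj_neq u v w : adj v w -> dist u w != dist u v.
Proof.
move=> vw; apply/negP=> E; have /eqP := (tree_counts u).2 v.
by apply/negP; rewrite -lt0n; apply/card_gt0P; exists w; rewrite inE vw.
Qed.

Lemma closerE u v w : w \in closer u v -> dist u v = (dist u w).+1.
Proof.
rewrite inE => /andP[vw lt]; apply/eqP; rewrite eqn_leq lt.
by rewrite dist_adj // adj_sym.
Qed.

(** All neighbours of [w] lie one step farther from [x], except the one on the
    way to [x], which lies one step closer. *)
Lemma sum_dist_neighbours x w :
  \sum_(y | adj w y) dist x y + 2 * (w != x) = degree w * (dist x w).+1.
Proof.
have -> : 2 * (w != x) = \sum_(y | adj w y) 2 * (y \in closer x w).
  rewrite -big_distrr -card_closer card_sum_mem /= [in RHS]big_mkcond /=.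
  by congr (2 * _); apply: eq_bigr => y _; rewrite inE; case: (adj w y).
rewrite -big_split -sum_nat_const; apply: eq_bigr => y wy /=.
have := dist_adj cG x wy; have := dist_adj_neq x wy.
have := @closerE x w y; rewrite inE wy /=; case: ltngtP => //= lt.
  by move=> -> // _ _; rewrite muln1 addn2.
by move=> _ _ le; rewrite muln0 addn0; apply/eqP; rewrite eqn_leq le.
Qed.

Lemma sum_transmission_neighbours w :
  \sum_(y | adj w y) transmission y + 2 * #|edge G|
    = degree w * (transmission w + #|G|).
Proof.
rewrite -(card_neq w) exchange_big big_distrr -big_split /=.
rewrite -sum1_card -big_split big_distrr /=; apply: eq_bigr => x _.
rewrite addn1 [x == w]eq_sym (dist_sym cG w x) -sum_dist_neighbours.
by congr (_ + _); apply: eq_bigr => y _; rewrite dist_sym.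
Qed.

(** The left-hand sum is the sum over the edges of the distances from [u] to
    their two ends, an edge with far end [v] contributing [2 d(u,v) - 1].  Each
    vertex other than [u] is the far end of exactly one edge. *)
Lemma sum_degree_dist u :
  \sum_v degree v * dist u v + #|edge G| = 2 * transmission u.
Proof.
have -> : \sum_v degree v * dist u v
    = \sum_v \sum_(w in closer u v) (dist u v + dist u w).
  under [RHS]eq_bigr do rewrite big_split /=.
  rewrite big_split /= -sum_farther -big_split; apply: eq_bigr => v _ /=.
  by rewrite !sum_nat_const -mulnDl (degree_split u) (tree_counts u).2 addn0.
rewrite -(card_neq u) -big_split big_distrr /=; apply: eq_bigr => v _.
rewrite -card_closer -sum1_card -big_split /=.
have -> : \sum_(w in closer u v) (dist u v + dist u w + 1)
    = \sum_(w in closer u v) 2 * dist u v.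
  by apply: eq_bigr => w /closerE; lia.
rewrite sum_nat_const card_closer.
by have [->|_] := eqVneq v u; rewrite ?dist_refl ?mul1n.
Qed.

Lemma sum_degree_transmission :
  \sum_(v : G) degree v * transmission v + #|G| * #|edge G|
    = 2 * \sum_(v : G) transmission v.
Proof.
rewrite -sum_nat_const big_distrr /=.
under [RHS]eq_bigr do rewrite -sum_degree_dist.
rewrite big_split; congr (_ + _) => /=.
rewrite exchange_big; apply: eq_bigr => v _; rewrite /= -big_distrr.
by congr (_ * _); apply: eq_bigr => u _; rewrite dist_sym.
Qed.

End Tree.

(** * The star fractal of a tree *)

Section StarFractalTree.
Local Open Scope nat_scope.
Variables (m : nat) (G : sgraph).
Let H := star_fractal m G.

Lemma sum_star_fractal (F : H -> nat) :
  \sum_(x : H) F x = \sum_(u : G) F (inl u)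
    + \sum_(e : edge G) (F (inr (e, None)) + \sum_(i < m) F (inr (e, Some i))).
Proof.
rewrite big_sumType /=; congr (_ + _).
rewrite (eq_bigr (fun p => F (inr (p.1, p.2)))) => [|[]//].
rewrite -(pair_bigA _ (fun e o => F (inr (e, o)))) /=.
apply: eq_bigr => e _; rewrite (bigD1 None) //=; congr (_ + _).
rewrite (reindex_omap Some id) => [|[]//].
by apply: eq_bigl => i; rewrite /= eqxx.
Qed.

Lemma card_star_fractal : #|H| = #|G| + m.+1 * #|edge G|.
Proof.
rewrite -!sum1_card sum_star_fractal; congr (_ + _).
rewrite big_distrr /=; apply: eq_bigr => e _.
by rewrite sum_nat_const card_ord !muln1.
Qed.

Lemma sum_adj_old (F : H -> nat) (u : G) :
  \sum_(y : H | adj (inl u : H) y) F y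
    = \sum_(e : edge G | u \in val e) F (inr (e, None)).
Proof.
rewrite big_mkcond sum_star_fractal big1 //= [RHS]big_mkcond.
by apply: eq_bigr => e _; rewrite big1 // addn0.
Qed.

Lemma sum_adj_mid (F : H -> nat) (e : edge G) :
  \sum_(y : H | adj (inr (e, None) : H) y) F y
    = \sum_(u in val e) F (inl u) + \sum_(i < m) F (inr (e, Some i)).
Proof.
rewrite big_mkcond sum_star_fractal /= -big_mkcond; congr (_ + _).
rewrite (bigD1 e) //= eqxx [X in _ + X]big1 ?addn0 // => f fe.
by rewrite eq_sym (negPf fe) big1.
Qed.

Lemma sum_adj_leaf (F : H -> nat) (e : edge G) i :
  \sum_(y : H | adj (inr (e, Some i) : H) y) F y = F (inr (e, None)).
Proof.
rewrite big_mkcond sum_star_fractal big1 //= (bigD1 e) //= eqxx.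
rewrite big1 // addn0 add0n [X in _ + X]big1 ?addn0 // => f fe.
by rewrite eq_sym (negPf fe).
Qed.

Lemma degreeE (K : sgraph) (x : K) : degree x = \sum_(y | adj x y) 1.
Proof. by rewrite /degree sum1_card. Qed.

Lemma degree_old (u : G) : degree (inl u : H) = degree u.
Proof. by rewrite degreeE sum_adj_old sum1_card card_incident. Qed.

Lemma degree_mid (e : edge G) : degree (inr (e, None) : H) = m.+2.
Proof.
rewrite degreeE sum_adj_mid !sum_nat_const !muln1 card_ord.
by have [a [b [_ ab ->]]] := edge_ends e; rewrite cards2 ab.
Qed.

Lemma degree_leaf (e : edge G) i : degree (inr (e, Some i) : H) = 1.
Proof. by rewrite degreeE sum_adj_leaf. Qed.

Lemma card_edge_star_fractal : #|edge H| = m.+2 * #|edge G|.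
Proof.
have := handshake H; rewrite sum_star_fractal.
under eq_bigr do rewrite degree_old.
under [X in _ + X]eq_bigr => e _.
  rewrite degree_mid; under eq_bigr do rewrite degree_leaf.
  rewrite sum_nat_const card_ord; over.
by rewrite handshake sum_edge_const; lia.
Qed.

Lemma star_fractal_tree : tree G -> tree H.
Proof.
case=> cG card; split; first exact: star_fractal_connected.
by rewrite card_edge_star_fractal card_star_fractal card; lia.
Qed.

Hypothesis tG : tree G.
Let cG : connected G := tG.1.
Let tH : tree H := star_fractal_tree tG.
Let cH : connected H := tH.1.

(** The distance from an inserted vertex to [u] is one more than twice the
    distance from the nearer end of its edge; the two ends differ by one, so
    this is the sum of their distances. *)
Definition dist_old (u : G) (x : H) : nat :=
  match x with
  | inl v => 2 * dist u v
  | inr (e, None) => \sum_(a in val e) dist u a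
  | inr (e, Some _) => (\sum_(a in val e) dist u a).+1
  end.

Lemma dist_oldE (u : G) (x : H) : dist (inl u : H) x = dist_old u x.
Proof.
have end_bound (e : edge G) v : v \in val e ->
    2 * dist u v <= (\sum_(a in val e) dist u a).+1 /\
    \sum_(a in val e) dist u a <= (2 * dist u v).+1.
  have [a [b [ab nab ->]]] := edge_ends e; rewrite sum_ends // !inE.
  have := dist_adj cG u ab; rewrite adj_sym in ab.
  by have := dist_adj cG u ab => ? ? /orP[]/eqP->; lia.
apply: dist_eqP => /= [|{}x y|{}x].
- by rewrite dist_refl.
- case: x y => [v|[e [i|]]] [w|[f [j|]]] //=.
  + by case/end_bound.
  + by move=> /eqP->; lia.
  + by case/end_bound.
  + by move=> /eqP->.
case: x => [v|[e [i|]]].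
- rewrite (inj_eq inl_inj) => vu; have [w vw lt] := dist_closer cG vu.
  have [e E] := edge_of_adj vw; exists (inr (e, None)) => /=.
    by rewrite E !inE eqxx.
  by rewrite E sum_ends; [lia|]; apply: contraTneq lt => ->; rewrite ltnn.
- by exists (inr (e, None)); rewrite /= ?eqxx.
move=> _; have [a [b [ab nab E]]] := edge_ends e.
have := dist_adj_neq tG u ab; rewrite neq_ltn => /orP[] lt.
  by exists (inl b); rewrite /= E ?inE ?eqxx ?orbT // sum_ends //; lia.
by exists (inl a); rewrite /= E ?inE ?eqxx // sum_ends //; lia.
Qed.

Lemma transmission_old (u : G) :
  transmission (inl u : H) + #|edge G| = (2 * m.+2) * transmission u.
Proof.
have old : \sum_v dist (inl u : H) (inl v) = 2 * transmission u.
  by rewrite /transmission big_distrr; apply: eq_bigr => v _; rewrite dist_oldE.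
have new (e : edge G) :
    dist (inl u : H) (inr (e, None))
      + \sum_(i < m) dist (inl u : H) (inr (e, Some i))
    = m.+1 * (\sum_(a in val e) dist u a) + m.
  rewrite dist_oldE (eq_bigr _ (fun i _ => dist_oldE u (inr (e, Some i)))) /=.
  by rewrite sum_nat_const card_ord mulnS addnCA -mulSn addnC.
rewrite {1}/transmission sum_star_fractal old (eq_bigr _ (fun e _ => new e)).
rewrite big_split sum_edge_const -big_distrr sum_edge_ends.
by have := sum_degree_dist tG u; move: (\sum_v _) #|edge G| => S E /=; nia.
Qed.

(** The second identity at a vertex of degree one: moving from a leaf to its
    neighbour changes the transmission by [n - 2]. *)
Lemma transmission_leaf (e : edge G) i :
  transmission (inr (e, Some i) : H) + 1
    = transmission (inr (e, None) : H) + #|edge H|.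
Proof.
have := sum_transmission_neighbours tH (inr (e, Some i)).
rewrite sum_adj_leaf degree_leaf tH.2; lia.
Qed.

Lemma sum_transmission_leaves (e : edge G) :
  \sum_(i < m) transmission (inr (e, Some i) : H) + m
    = m * (transmission (inr (e, None) : H) + #|edge H|).
Proof.
transitivity (\sum_(i < m) (transmission (inr (e, Some i) : H) + 1)).
  by rewrite big_split sum_nat_const card_ord muln1.
rewrite (eq_bigr _ (fun i _ => transmission_leaf e i)).
by rewrite sum_nat_const card_ord.
Qed.

(** An inserted vertex is halfway between the ends [a], [b] of its edge, so
    each vertex outside the inserted star has its distance to it equal to the
    mean of its distances to [a] and [b]; the [m + 1] vertices of that star
    are closer than this mean by one. *)
Lemma transmission_mid (e : edge G) :
  2 * transmission (inr (e, None) : H) + 2 * m.+1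
    = \sum_(u in val e) transmission (inl u : H).
Proof.
have := sum_transmission_neighbours tH (inr (e, None)).
rewrite sum_adj_mid degree_mid tH.2.
have : \sum_(i < m) transmission (inr (e, Some i) : H) + m
    = m * (transmission (inr (e, None) : H) + #|edge H|).
  by rewrite sum_transmission_leaves.
nia.
Qed.

(** Linear algebra on six relations, whose unknowns are the sums of the
    transmissions over the old, the inserted and the pendant vertices and the
    two degree-weighted sums. *)
Lemma geodesic_distance_star_fractal :
  geodesic_distance H + m.+2 * #|edge G| * (#|edge G| + m.+1)
    = 2 * m.+2 ^ 2 * geodesic_distance G.
Proof.
have distG := geodesic_distance2 cG; have distH := geodesic_distance2 cH.
rewrite sum_star_fractal in distH.
have mids : 2 * (\sum_e transmission (inr (e, None) : H)) + 2 * m.+1 * #|edge G|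
    = \sum_u degree u * transmission (inl u : H).
  rewrite -sum_edge_ends -(eq_bigr _ (fun e _ => transmission_mid e)).
  by rewrite big_split sum_edge_const big_distrr [#|edge G| * _]mulnC.
have leaves :
    \sum_e \sum_(i < m) transmission (inr (e, Some i) : H) + m * #|edge G|
    = m * ((\sum_e transmission (inr (e, None) : H))
           + m.+2 * #|edge G| * #|edge G|).
  rewrite [m * #|edge G|]mulnC -sum_edge_const -big_split.
  rewrite (eq_bigr _ (fun e _ => sum_transmission_leaves e)) -big_distrr.
  by rewrite big_split sum_edge_const card_edge_star_fractal [#|edge G| * _]mulnC.
have olds : \sum_u transmission (inl u : H) + #|edge G|.+1 * #|edge G|
    = 2 * m.+2 * (2 * geodesic_distance G).
  rewrite distG big_distrr -(eq_bigr _ (fun u _ => transmission_old u)).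
  by rewrite big_split sum_nat_const tG.2.
have wolds :
    \sum_u degree u * transmission (inl u : H) + 2 * #|edge G| * #|edge G|
    = 2 * m.+2 * \sum_(u : G) degree u * transmission u.
  rewrite -handshake big_distrl big_distrr -big_split; apply: eq_bigr => u _ /=.
  by rewrite -mulnDr [RHS]mulnCA -transmission_old.
have degs := sum_degree_transmission tG; rewrite -distG tG.2 in degs.
rewrite big_split /= in distH.
move: distH mids leaves olds wolds degs.
move: (\sum_e transmission _) (\sum_e \sum_(i < m) _) (\sum_u transmission _).
move: (\sum_u degree u * transmission (inl u : H)).
move: (\sum_u degree u * transmission u).
move: (geodesic_distance H) (geodesic_distance G) #|edge G|.
move=> W' W E M B X L A distH mids leaves olds wolds degs.
(* After multiplication by these factors, the result is a linear combination
   of the relations, with monomials as unknowns. *)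
have mids' := congr1 (muln m.+1) mids.
have wolds' := congr1 (muln m.+1) wolds.
have degs' := congr1 (muln (m.+1 * (2 * m.+2))) degs.
nia.
Qed.

End StarFractalTree.

(** * Iterating the operation on a single edge *)

Section StarFractalIteration.
Local Open Scope nat_scope.
Variable m : nat.

Lemma card_edge_single : #|edge single_edge| = 1.
Proof.
apply/eqP; rewrite -(eqn_pmul2l (isT : 0 < 2)) -handshake.
by rewrite big_bool /degree !card_sum_mem !big_bool.
Qed.

Lemma N_tree t : tree (N t m).
Proof.
elim: t => [|t IH]; last exact: star_fractal_tree.
by split; [exact: (@N_connected 0 m) | rewrite card_edge_single card_bool].
Qed.

Lemma card_edge_N t : #|edge (N t m)| = m.+2 ^ t.
Proof.
elim: t => [|t IH]; first exact: card_edge_single.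
by rewrite card_edge_star_fractal IH -expnS.
Qed.

Lemma geodesic_distance_single : geodesic_distance single_edge = 1.
Proof.
have d (u v : single_edge) : dist u v = (v != u).
  apply: (@dist_eqP single_edge u (fun v => v != u)) => [|x y _|x xu].
  - by rewrite eqxx.
  - by case: (y != u).
  by exists u; rewrite ?eqxx ?xu.
apply/eqP; rewrite -(eqn_pmul2l (isT : 0 < 2)).
rewrite geodesic_distance2; last exact: (@N_connected 0 m).
by rewrite /transmission !(big_bool, d).
Qed.

(** The closed form with denominators and negative terms cleared; in this shape
    it also covers [t = 0]. *)
Lemma geodesic_distance_N t :
  (2 * m + 3) * m.+2 * geodesic_distance (N t m) + m.+2 ^ 2 * m.+2 ^ t
    = (m.+1 ^ 2 * 2 ^ t + (2 * m + 3)) * (m.+2 ^ t) ^ 2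
      + (2 * m + 3) * m.+2 * m.+2 ^ t.
Proof.
elim: t => [|t IH].
  by rewrite [N 0 m]/single_edge geodesic_distance_single !expn0; nia.
have := geodesic_distance_star_fractal m (N_tree t).
rewrite card_edge_N -[star_fractal m _]/(N t.+1 m) !(expnS _ t).
move: IH; move: (geodesic_distance _) (geodesic_distance _) (m.+2 ^ t) (2 ^ t).
move=> W' W Q P IH rec.
(* These factors make the coefficients of [W] agree, so that it cancels. *)
have := congr1 (muln (2 * m.+2 * m.+2)) IH.
have := congr1 (muln ((2 * m + 3) * m.+2)) rec.
lia.
Qed.

End StarFractalIteration.

Theorem corollary4 (m t : nat) (ht : (1 <= t)%N) :
  (geodesic_distance (N t m))%:R =
    ((m%:R ^+ 2 + 2 * m%:R + 1) * 2 ^+ t + 2 * m%:R + 3) / (2 * m%:R + 3)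
      * (m%:R + 2) ^+ (2 * t - 1)
    + (m%:R + 2) ^+ t
    - (m%:R + 2) ^+ 2 / (2 * m%:R + 3) * (m%:R + 2) ^+ (t - 1)
  :> rat.
Proof.
case: t ht => // t _.
have -> : (2 * t.+1 - 1 = t + t + 1)%N by lia.
have -> : (t.+1 - 1 = t)%N by lia.
have := congr1 (fun n => n%:R : rat) (geodesic_distance_N m t.+1).
rewrite -![m.+2]addn2 -![m.+1]addn1 !(natrD, natrM, natrX).
rewrite !(exprS _ t) !exprD expr1.
have m0 : 0 <= m%:R :> rat by [].
have d3 : 2 * m%:R + 3 != 0 :> rat by rewrite lt0r_neq0 // ltr_wpDl // mulr_ge0.
have d2 : m%:R + 2 != 0 :> rat by rewrite lt0r_neq0 // ltr_wpDl.
move: (m%:R : rat) (geodesic_distance _)%:R m0 d3 d2 => x W m0 d3 d2 eqW.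
apply: (mulfI (mulf_neq0 d3 d2)).
(* The subtracted term of the formula, cleared of its denominator, returns to
   the side where [geodesic_distance_N] has it. *)
apply: (addIr ((x + 2) ^+ 2 * ((x + 2) * (x + 2) ^+ t))).
rewrite [LHS]eqW.
by field.
Qed.
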